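(* Let $0<D<1$, let $\{\eta_j\}_{j=0}^\infty\in l^1$ be any sequence of complex numbers whose moments never vanish, i.e. $M_m(\{\eta_j\})\neq 0$ for all integers $m\geq 1$, and let $\{p_k\}_{k=0}^\infty$ be a strictly increasing sequence of primes such that $\prod_{k=0}^\infty\left(1-\frac1{p_k}\right)=1-D$ (such sequences of primes exist for every such $D$). Define the countable sets with repetitions (multisets) $$I_k=\left\{\eta_j\,\frac{\omega_{p_k}^{l}}{2^k} : j\geq 0,\ 0\leq l\leq p_k-1\right\},\quad k\geq 0,\qquad I=\bigcup_{k=0}^\infty I_k,$$ so that $I$ is the family indexed by all triples $(k,j,l)$ with $k,j\geq 0$ and $0\leq l\leq p_k-1$, and let $\{\xi_j\}_{j=0}^\infty$ be given by a bijection $\xi:\{0,1,2,3,\ldots\}\to I$ (elements of $I$ counted with repetitions). Then the sequence $\{\xi_j\}_{j=0}^\infty$ thus constructed has moments that vanish with density $1-D$.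
   Context: For a sequence of complex numbers $\{z_j\}_{j=0}^\infty$, the moments are $M_m(\{z_j\})=\sum_{j=0}^\infty z_j^m$. For $n\geq 2$, $\omega_n=e^{2\pi i/n}$. The moments of $\{z_j\}$ vanish with density $d$ if $d=\lim_{n\to\infty}\frac{|\{k\in\mathbb{N} : M_k(\{z_j\})=0,\ 0\leq k\leq n\}|}{n+1}$.
   Formalization: The claim for every bijection is proved only when ξ lies in some l^q (otherwise the moments of ξ depend on the order and may diverge); for arbitrary admissible primes p_k it is proved that some bijection ξ has all moments m≥1 convergent and vanishing with density 1−D. *)

(* Defs.v *)
(* The complex numbers are R[i], over an arbitrary R : realType. *)
From HB Require Import structures.
From mathcomp Require Import all_boot all_order all_algebra.
From mathcomp Require Import complex.
From mathcomp Require Import all_classical all_reals all_analysis.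
Set Implicit Arguments.
Unset Strict Implicit.
Unset Printing Implicit Defensive.
Import Order.TTheory GRing.Theory Num.Theory.
Import numFieldNormedType.Exports.
Local Open Scope classical_set_scope.
Local Open Scope ring_scope.
Local Open Scope complex_scope.

(* The first definitions are over a numFieldType K, whose topology is the one
   given by its norm; they are used at K := R[i]. *)

Definition ell1 (K : numFieldType) (z : nat -> K) : Prop :=
  cvgn [normed series z].

Definition moment_series (K : numFieldType) (z : nat -> K) (m : nat) : nat -> K :=
  series (fun j => z j ^+ m).

(* [limn] is total, so this is the m-th moment only when the series converges. *)
Definition moment (K : numFieldType) (z : nat -> K) (m : nat) : K :=
  limn (moment_series z m).

(* A divergent moment is not a vanishing one; in particular the zeroth moment,
   a sum of infinitely many ones, never vanishes. *)
Definition moment_vanishes (K : numFieldType) (z : nat -> K) (m : nat) : Prop :=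
  cvgn (moment_series z m) /\ moment z m = 0.

Definition moments_vanish_with_density (R : realType) (z : nat -> R[i]) (d : R)
    : Prop :=
  (fun n : nat =>
     #|[pred k : 'I_n.+1 | `[< moment_vanishes z k >]]|%:R / n.+1%:R : R)
    @ \oo --> d.

Definition omega_root (R : realType) (n : nat) : R[i] :=
  cos (2 * pi / n%:R) +i* sin (2 * pi / n%:R).

Definition admissible_primes (R : realType) (D : R) (p : nat -> nat) : Prop :=
  [/\ {homo p : i j / (i < j)%N},
      forall k, prime (p k) &
      (fun n : nat => \prod_(0 <= k < n) (1 - (p k)%:R^-1) : R) @ \oo --> 1 - D].

(* The triples (k, j, l) with l < p k; repetitions in the multiset I are
   accounted for by indexing it with them. *)
Definition index_I (p : nat -> nat) : Type := {k : nat & (nat * 'I_(p k))%type}.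

Definition elt_I (R : realType) (eta : nat -> R[i]) (p : nat -> nat)
    (t : index_I p) : R[i] :=
  let: existT k (j, l) := t in eta j * (omega_root R (p k) ^+ l / 2 ^+ k).

(* Main.v *)
Require Import Defs.
From HB Require Import structures.
From mathcomp Require Import all_boot all_order all_algebra.
From mathcomp Require Import complex.
From mathcomp Require Import all_classical all_reals all_analysis.
From mathcomp Require Import zify ring lra.
Import Order.TTheory GRing.Theory Num.Theory.
Import numFieldNormedType.Exports.
Local Open Scope classical_set_scope.
Local Open Scope ring_scope.
Local Open Scope complex_scope.

(** Summing over l first, the block of (k, j) contributes to the m-th moment
    eta_j^m / 2^(km) times the sum of the m-th powers of the p_k-th roots of
    unity, which is p_k if p_k divides m and 0 otherwise. For m >= 1 only the
    finitely many k with p_k <= m can contribute, so the m-th moment is W_m times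
    the m-th moment of eta, where W_m is the finite sum of the p_k / 2^(km) over
    the k with p_k | m. These terms are positive: the moment vanishes exactly
    when no p_k divides m.

    The integers with that property have density prod (1 - 1/p_k) = 1 - D
    ([density_of_sieved]). Sieving by finitely many primes is exact up to a
    bounded error, and the integers lost to the remaining primes have density at
    most the tail of sum 1/p_k, which the Euler product itself controls as soon
    as its limit is positive.

    The same density statement yields the existence of the primes. Applied to
    all primes, whose sieve leaves only the integer 1, it shows that the Euler
    product over all primes is 0 ([euler_prod_primes_cvg0]). The greedy choice,
    which accepts a prime whenever the product stays above 1 - D, then converges
    to 1 - D: with a larger limit it would eventually accept every prime.

    What remains is to justify the summation order. If the m-th powers of the
    enumerated family are absolutely summable, the sums over the boxes k < J,
    j < J converge to the moment ([abs_moment_cvg]). In general p_k / 2^(km) may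
    be unbounded and the family need not lie in any l^q. An enumeration with all
    moments convergent is obtained by listing the blocks one after the other,
    and listing block (k, j) with l running through the multiples of
    g = floor (p_k / (k + 2)) modulo p_k. Its partial sums of m-th powers are
    then geometric sums of ratio exp (2 i pi g m / p_k); for m small compared
    with k this ratio stays at distance at least 1 / (k + 2) from 1, so the
    partial sums are at most 2 (k + 2) whatever the size of p_k
    ([stride_partial_sum]), and the factor 2^(-km) makes them negligible
    ([strided_moment_cvg]). *)

Set Implicit Arguments.
Unset Strict Implicit.
Unset Printing Implicit Defensive.

(** * Sieving by a set of primes *)

Section Sieve.
Variable S : pred nat.
Hypothesis S_prime : forall i, S i -> prime i.

(** Survival of m when only the elements of [S] below n are used, so that a
    single recursion over n adds the primes one at a time. *)
Definition sieved (n m : nat) : bool := all (fun i => S i ==> ~~ (i %| m)%N) (iota 0 n).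
Definition sieve_count (n X : nat) : nat := \sum_(m < X) sieved n m.

Lemma sievedS n m : sieved n.+1 m = sieved n m && (S n ==> ~~ (n %| m)%N).
Proof. by rewrite /sieved -addn1 iotaD all_cat /= andbT add0n. Qed.

Lemma sieved_mul n m : S n -> sieved n (n * m) = sieved n m.
Proof.
move=> Sn; apply: eq_in_all => i; rewrite mem_iota add0n /= => lt_in.
case Si: (S i) => //=; congr (~~ _).
rewrite Gauss_dvdr // prime_coprime ?S_prime //.
by rewrite dvdn_prime2 ?S_prime // ltn_eqF.
Qed.

Lemma sum_multiples (F : nat -> nat) (d X : nat) : (0 < d)%N ->
  (\sum_(m < X | d %| m) F m = \sum_(m < (X + d.-1) %/ d) F (d * m))%N.
Proof.
move=> d_gt0; elim: X => [|X IH].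
  by rewrite add0n divn_small ?prednK // !big_ord0.
rewrite big_mkcond big_ord_recr /= -big_mkcond /= IH.
(* The number of multiples of d below X grows exactly when d divides X. *)
case: ifPn => [/dvdnP[q ->]|dX].
  have -> : (((q * d).+1 + d.-1) %/ d = q.+1)%N.
    by rewrite addSnnS prednK // divnMDl // divnn d_gt0 addn1.
  have -> : ((q * d + d.-1) %/ d = q)%N.
    by rewrite divnMDl // divn_small ?addn0 ?prednK.
  by rewrite big_ord_recr /= mulnC.
rewrite addn0; suff -> : ((X.+1 + d.-1) %/ d = (X + d.-1) %/ d)%N by [].
have := divn_eq X d; move: (ltn_pmod X d_gt0) dX; rewrite /dvdn.
move: (X %% d)%N (X %/ d)%N => r q lt_rd r0 ->.
have -> : ((q * d + r).+1 + d.-1 = q.+1 * d + r)%N by lia.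
have -> : (q * d + r + d.-1 = q.+1 * d + r.-1)%N by lia.
by rewrite !divnMDl // !divn_small //; lia.
Qed.

(** The integers removed at step n are the n * m', and since n is coprime to
    the other primes, n * m' survives the first n steps exactly when m' does:
    the removed ones form a sieved interval n times shorter. *)
Lemma sieve_countS n X : S n ->
  (sieve_count n X = sieve_count n.+1 X + sieve_count n ((X + n.-1) %/ n))%N.
Proof.
move=> Sn; have n_gt0 : (0 < n)%N by rewrite prime_gt0 ?S_prime.
have -> : sieve_count n ((X + n.-1) %/ n) = (\sum_(m < X | n %| m) sieved n m)%N.
  rewrite (sum_multiples (fun m => sieved n m : nat)) //.
  by apply: eq_bigr => m _; rewrite sieved_mul.
rewrite big_mkcond -big_split /=; apply: eq_bigr => m _.
by rewrite sievedS Sn /=; case: (sieved n m); case: (n %| m)%N.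
Qed.

End Sieve.

Section Density.
Variables (R : realType) (S : pred nat).
Hypothesis S_prime : forall i, S i -> prime i.

Definition euler_prod (n : nat) : R := \prod_(0 <= i < n | S i) (1 - i%:R^-1).

Lemma euler_factor_gt0 i : S i -> 0 < 1 - i%:R^-1 :> R.
Proof.
move=> /S_prime/prime_gt1 i_gt1; rewrite subr_gt0 invf_lt1 ?ltr1n // ltr0n; lia.
Qed.

Lemma euler_factor_le1 i : 1 - i%:R^-1 <= 1 :> R.
Proof. by rewrite gerBl invr_ge0. Qed.

Lemma euler_prodS n :
  euler_prod n.+1 = if S n then euler_prod n * (1 - n%:R^-1) else euler_prod n.
Proof.
rewrite /euler_prod big_mkcond big_nat_recr //= -big_mkcond /=.
by case: ifP; rewrite ?mulr1.
Qed.

Lemma euler_prod_gt0 n : 0 < euler_prod n.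
Proof. by apply: prodr_gt0 => i Si; apply: euler_factor_gt0. Qed.

Lemma euler_prod_nonincreasing : nonincreasing_seq euler_prod.
Proof.
apply/nonincreasing_seqP => n; rewrite euler_prodS; case: ifP => // _.
by rewrite ler_piMr ?euler_factor_le1 // ltW ?euler_prod_gt0.
Qed.

Lemma euler_prod_le1 n : euler_prod n <= 1.
Proof.
by have := euler_prod_nonincreasing (leq0n n); rewrite {2}/euler_prod big_nil.
Qed.

(** Each new prime at most doubles the error and adds 1 for rounding the
    length of the shorter interval, hence a bound independent of X. *)
Lemma sieve_count_approx n X :
  `| (sieve_count S n X)%:R - X%:R * euler_prod n | <= 2 ^+ n - 1 :> R.
Proof.
elim: n X => [|n IH] X.
  rewrite /euler_prod big_nil mulr1 expr0 subrr /sieve_count /sieved /=.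
  by rewrite sum_nat_const card_ord muln1 subrr normr0.
rewrite euler_prodS; case: ifPn => [Sn|/negbTE Sn]; last first.
  have -> : sieve_count S n.+1 X = sieve_count S n X.
    by apply: eq_bigr => m _; rewrite sievedS Sn andbT.
  apply: (le_trans (IH X)); rewrite lerD2r ler_eXn2l //; lra.
have n_gt0 : (0 < n)%N by rewrite prime_gt0 ?S_prime.
set c := ((X + n.-1) %/ n)%N.
have cE : (sieve_count S n.+1 X)%:R =
    (sieve_count S n X)%:R - (sieve_count S n c)%:R :> R.
  by rewrite (sieve_countS S_prime X Sn) natrD addrK.
have n0 : 0 < n%:R :> R by rewrite ltr0n.
have c_ge : X%:R / n%:R <= c%:R :> R.
  rewrite ler_pdivrMr // -natrM ler_nat.
  have := divn_eq (X + n.-1) n; rewrite -/c; have := ltn_pmod (X + n.-1) n_gt0; lia.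
have c_le : c%:R <= X%:R / n%:R + 1 :> R.
  rewrite -(ler_pM2r n0) mulrDl mul1r divfK ?gt_eqF // -natrD -natrM ler_nat.
  have := leq_trunc_div (X + n.-1) n; rewrite -/c; lia.
have := IH X; have := IH c; rewrite cE !ler_norml exprS.
have P0 := euler_prod_gt0 n; have P1 := euler_prod_le1 n.
have -> : X%:R * (euler_prod n * (1 - n%:R^-1)) =
    X%:R * euler_prod n - X%:R / n%:R * euler_prod n by ring.
move: c_ge c_le P0 P1; set x := X%:R / n%:R.
move: (euler_prod n) => P cx1 cx2 P0 P1 /andP[h1 h2] /andP[h3 h4].
have h5 : (c%:R - x) * P <= 1 by nra.
have h6 : 0 <= (c%:R - x) * P by nra.
by apply/andP; split; lra.
Qed.

(** Each step rests on (1 - x) (1 + s + x) <= 1 + s. This bounds the tail of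
    the sum of reciprocals by the relative decrease of the Euler product. *)
Lemma euler_prod_tail n N : (n <= N)%N ->
  euler_prod N * (1 + \sum_(n <= i < N | S i) i%:R^-1) <= euler_prod n.
Proof.
elim: N => [|N IH]; first by rewrite leqn0 => /eqP ->; rewrite big_nil addr0 mulr1.
rewrite leq_eqVlt => /predU1P[<-|lt_nN]; first by rewrite big_geq // addr0 mulr1.
apply: le_trans (IH lt_nN); rewrite euler_prodS big_mkcond big_nat_recr //= -big_mkcond /=.
case: ifPn => SN; last by rewrite addr0.
rewrite -mulrA ler_pM2l ?euler_prod_gt0 //.
have : 0 <= N%:R^-1 :> R by rewrite invr_ge0.
have : 0 <= \sum_(n <= i < N | S i) i%:R^-1 :> R by apply: sumr_ge0 => i _; rewrite invr_ge0.
move: (\sum_(_ <= _ < _ | _) _) (N%:R^-1) => s x s0 x0; nra.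
Qed.

Lemma card_ord_sum (V : pred nat) n : #|[pred k : 'I_n | V k]| = (\sum_(m < n) V m)%N.
Proof. by rewrite -sum1_card big_mkcond; apply: eq_bigr => i _; rewrite inE; case: (V i). Qed.

(** The multiple 0 is left out, and with it the rounding error. *)
Lemma sum_pos_multiples_le d X : (0 < d)%N ->
  (\sum_(m < X) ((0 < m) && (d %| m)))%N%:R <= X%:R / d%:R :> R.
Proof.
move=> d0; rewrite ler_pdivlMr ?ltr0n // -natrM ler_nat.
have -> : (\sum_(m < X) ((0 < m) && (d %| m)) = \sum_(m < X | d %| m) (0 < m))%N.
  by rewrite [RHS]big_mkcond; apply: eq_bigr => m _; case: (d %| m)%N; rewrite ?andbT ?andbF.
rewrite (sum_multiples (fun m => (0 < m)%N : nat)) //.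
have := leq_trunc_div (X + d.-1) d; case: (_ %/ _)%N => [|c]; first by rewrite big_ord0.
rewrite big_ord_recl muln0 ltnn add0n => le_c.
have : (\sum_(i < c) (0 < d * lift ord0 i) <= \sum_(i < c) 1)%N.
  by apply: leq_sum => i _; apply: leq_b1.
rewrite sum1_card card_ord => le_s; have := leq_mul2r d (\sum_(i < c) (0 < d * lift ord0 i)) c.
rewrite le_s orbT; lia.
Qed.

Lemma sum_ltn_le q X : (\sum_(m < X) (m < q) <= q)%N.
Proof.
elim: X => [|X IH]; first by rewrite big_ord0.
rewrite big_ord_recr /=; case: ltnP => [lt_Xq|]; last by rewrite addn0.
apply: (@leq_trans (\sum_(i < X) 1 + 1)); last by rewrite sum1_card card_ord addn1.
by rewrite leq_add2r; apply: leq_sum => i _; apply: leq_b1.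
Qed.

Section Agree.
Variables (V : pred nat) (q : nat).
Hypothesis V_sieve : forall m, (q <= m)%N -> V m <-> (forall i, S i -> ~~ (i %| m)%N).

(** Only the exceptions below q can exceed the count of the finite sieve. *)
Lemma count_le_sieve n X : (\sum_(m < X) V m <= sieve_count S n X + q)%N.
Proof.
have -> : (sieve_count S n X + q = \sum_(m < X) sieved S n m + q)%N by [].
apply: leq_trans (leq_add (leqnn _) (sum_ltn_le q X)); rewrite -big_split /=; apply: leq_sum => m _.
case: (ltnP m q) => [_|q_m]; first by case: (V m); case: (sieved S n m).
case Vm: (V m) => //; rewrite addn0 /= lt0b.
by apply/allP => i _; apply/implyP => Si; apply: (V_sieve q_m).1.
Qed.

(** A survivor m > q of the finite sieve that is not counted by [V] has a
    divisor in [S] that is at least n, and less than X since m is. *)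
Lemma sieve_le_count n X : (sieve_count S n X <=
  \sum_(m < X) V m + q.+1 + \sum_(n <= i < X | S i) \sum_(m < X) ((0 < m) && (i %| m)))%N.
Proof.
apply: leq_trans (leq_add (leq_add (leqnn _) (sum_ltn_le q.+1 X)) (leqnn _)).
rewrite exchange_big -!big_split /=; apply: leq_sum => m _.
case sm: (sieved S n m) => //; case: (ltnP m q.+1) => [|q_m].
  by move=> _; rewrite addnC addnA addn1.
rewrite addn0; case Vm: (V m); first by rewrite addSn.
have /existsNP[i /not_implyP[Si /negP]] : ~ (forall i, S i -> ~~ (i %| m)%N).
  by move=> /(V_sieve (ltnW q_m)); rewrite Vm.
rewrite negbK => im; have m0 : (0 < m)%N by apply: leq_ltn_trans q_m.
have le_im := dvdn_leq m0 im.
have le_ni : (n <= i)%N.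
  rewrite leqNgt; apply/negP => lt_in; move/allP: sm => /(_ i).
  by rewrite mem_iota lt_in Si im => /(_ isT).
have i_in : i \in index_iota n X by rewrite mem_index_iota le_ni (leq_ltn_trans le_im).
rewrite add0n big_mkcond (big_rem _ i_in) /= Si m0 im; lia.
Qed.

(** Truncating the sieve at n changes the density by at most the tail of the
    sum of reciprocals, hence by (P_n - L) / L for the partial product P_n; this
    tends to 0 because L > 0. The predicate is constrained only from q on,
    since finitely many integers do not affect a density. *)
Lemma density_of_sieved (L : R) : 0 < L -> euler_prod @ \oo --> L ->
  (fun n : nat => #|[pred k : 'I_n.+1 | V k]|%:R / n.+1%:R : R) @ \oo --> L.
Proof.
move=> L0 PL; have L_le n : L <= euler_prod n.
  rewrite -(cvg_lim _ PL) //; apply: nonincreasing_cvgn_ge; last by apply/cvg_ex; exists L.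
  exact: euler_prod_nonincreasing.
apply/cvgrPdist_le => e e0.
(* The factor L cancels the one in the tail bound (P_n - L) / L. *)
have [n _ /(_ n (leqnn _)) nL] : \forall n \near \oo, `|L - euler_prod n| <= L * (e / 2).
  by move/cvgrPdist_le: PL; apply; rewrite mulr_gt0 // divr_gt0.
(* The total error made at the fixed level n: sieve error plus exceptions. *)
pose B : R := 2 ^+ n + q.+1%:R.
have [N _ NB] : \forall N \near \oo, B / (e / 2) <= N%:R.
  exact: nbhs_infty_ger.
near=> X0; set X := X0.+1; have X_gt0 : 0 < X%:R :> R by rewrite ltr0n.
have BX : B <= e / 2 * X%:R.
  rewrite mulrC -ler_pdivrMr ?divr_gt0 //.
  apply: NB; rewrite /= /X leqW //; near: X0; exact: nbhs_infty_ge.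
rewrite card_ord_sum; set c := (\sum_(m < X) V m)%N.
have c_le : c%:R <= (sieve_count S n X)%:R + q%:R :> R.
  by rewrite -natrD ler_nat count_le_sieve.
pose s : R := \sum_(n <= i < X | S i) i%:R^-1.
have c_ge : (sieve_count S n X)%:R <= c%:R + q.+1%:R + X%:R * s :> R.
  apply: le_trans (_ : (c + q.+1 + \sum_(n <= i < X | S i)
      \sum_(m < X) ((0 < m) && (i %| m)))%N%:R <= _).
    by rewrite ler_nat sieve_le_count.
  rewrite !natrD lerD2l natr_sum mulr_sumr; apply: ler_sum => i Si.
  by apply: sum_pos_multiples_le; rewrite prime_gt0 ?S_prime.
have s_le : L * (1 + s) <= euler_prod n.
  case: (leqP n X) => nX; last by rewrite /s big_geq ?addr0 ?mulr1 // ltnW.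
  apply: le_trans (euler_prod_tail nX); rewrite ler_wpM2r //.
  by rewrite addr_ge0 //; apply: sumr_ge0 => i _; rewrite invr_ge0.
have := sieve_count_approx n X; rewrite ler_norml => /andP[sc1 sc2].
have P1 := euler_prod_le1 n; have LP := L_le n.
have qq : q.+1%:R = q%:R + 1 :> R by rewrite -natr1.
rewrite -(ler_pM2r X_gt0) -[X in _ * X <= _]gtr0_norm // -normrM mulrBl divfK ?gt_eqF //.
move: nL; rewrite ler_distlC => /andP[nL1 nL2].
have s_le2 : s <= e / 2.
  have : L * s <= L * (e / 2) by lra.
  by rewrite ler_pM2l.
have Xs : X%:R * s <= X%:R * (e / 2) by rewrite ler_pM2l.
have XP : X%:R * (euler_prod n - L) <= X%:R * (e / 2).
  rewrite ler_pM2l //; have : L * (e / 2) <= e / 2 by rewrite ler_piMl; lra.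
  lra.
have XP0 : 0 <= X%:R * (euler_prod n - L) by rewrite mulr_ge0 // ?subr_ge0 // ltW.
have q0 : 0 <= q%:R :> R by [].
rewrite ler_norml; apply/andP; rewrite /B in BX; split; lra.
Unshelve. all: by end_near. Qed.

End Agree.

End Density.

(** * The Euler product over all primes vanishes *)

Section Euler.
Variable R : realType.

Lemma euler_prod_is_cvg (S : pred nat) : (forall i, S i -> prime i) ->
  cvgn (euler_prod R S).
Proof.
move=> S_prime; apply: nonincreasing_is_cvgn; first exact: euler_prod_nonincreasing.
by exists 0 => _ [n _ <-]; rewrite ltW // euler_prod_gt0.
Qed.

Lemma euler_prod_ge_lim (S : pred nat) n : (forall i, S i -> prime i) ->
  limn (euler_prod R S) <= euler_prod R S n.
Proof.
move=> S_prime; apply: nonincreasing_cvgn_ge; last exact: euler_prod_is_cvg.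
exact: euler_prod_nonincreasing.
Qed.

(** A positive limit would be the density of the integers without prime
    divisors, but 1 is the only such integer. *)
Lemma euler_prod_primes_cvg0 : euler_prod R prime @ \oo --> 0.
Proof.
have pr : forall i, prime i -> prime i by [].
have Pc := @euler_prod_is_cvg prime pr.
set L : R := limn (euler_prod R prime).
have L_ge0 : 0 <= L.
  by apply: limr_ge => //; near=> n; rewrite ltW // euler_prod_gt0.
suff <- : L = 0 by exact: Pc.
apply/eqP; rewrite eq_le L_ge0 andbT leNgt; apply/negP => L_gt0.
(* Every prime divides 0, so 0 does not survive the sieve either. *)
have V_sieve m : (0 <= m)%N -> (m == 1)%N <-> (forall i, prime i -> ~~ (i %| m)%N).
  move=> _; split=> [/eqP -> i pi|h]; first by rewrite dvdn1; case: i pi => [|[]].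
  apply/negPn/negP => m1.
  have /= := h _ (pdiv_prime _ : prime (pdiv m)); rewrite pdiv_dvd => /(_ _)/negP; apply=> //.
  case: m h m1 => [h _|[|]//]; by have := h 2 isT; rewrite dvdn0.
have := @density_of_sieved R prime pr (pred1 1%N) 0 V_sieve L L_gt0 Pc.
have L2_gt0 : 0 < L / 2 by rewrite divr_gt0.
move/cvgrPdist_lt => /(_ _ L2_gt0) [N _ NB].
have [M _ /(_ M (leqnn _)) MB] : \forall M \near \oo, (2 / L) <= M%:R :> R.
  exact: nbhs_infty_ger.
have := NB (N + M)%N (leq_addr _ _).
set c : R := _%:R; have c1 : c <= 1.
  rewrite /c card_ord_sum -[leRHS]/(1%:R) ler_nat.
  have -> : (\sum_(m < (N + M).+1) (pred1 1%N m) = \sum_(m < (N + M).+1 | m == 1 :> nat) 1)%N.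
    by rewrite [RHS]big_mkcond; apply: eq_bigr => m _ /=; case: eqP.
  rewrite sum1_card; apply/card_le1_eqP => x y /eqP x1 /eqP y1.
  by apply: val_inj; rewrite /= x1 y1.
have X0 : 0 < (N + M).+1%:R :> R by rewrite ltr0n.
rewrite ltr_norml => /andP[_]; rewrite ltrBlDl -ltrBlDr => h.
have : L / 2 * (N + M).+1%:R < 1.
  apply: lt_le_trans c1; rewrite -ltr_pdivlMr //.
  by apply: le_lt_trans h; lra.
apply/negP; rewrite -leNgt mulrC -ler_pdivrMr ?divr_gt0 // mul1r invf_div.
by apply: (le_trans MB); rewrite ler_nat leqW // leq_addl.
Unshelve. all: by end_near. Qed.

End Euler.

(** * Prime sequences with a prescribed Euler product *)

Lemma increasing_ge_id (p : nat -> nat) : {homo p : i j / (i < j)%N} ->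
  forall k, (k <= p k)%N.
Proof. by move=> p_incr; elim=> // k IH; apply: leq_ltn_trans IH (p_incr _ _ _). Qed.

(** Each term is the least element of [S] above the previous one. *)
Lemma enumerate_infinite (S : pred nat) : (forall N, exists2 n, (N <= n)%N & S n) ->
  exists p : nat -> nat, [/\ {homo p : i j / (i < j)%N}, forall k, S (p k) &
    forall i, S i -> exists k, p k = i].
Proof.
move=> S_inf; have S_inf' N : exists n, (N <= n)%N && S n.
  by have [n Nn Sn] := S_inf N; exists n; rewrite Nn.
pose next N := ex_minn (S_inf' N).
pose p n := iter n (fun i => next i.+1) (next 0).
have pS n : p n.+1 = next (p n).+1 by [].
have next_ge N : (N <= next N)%N by rewrite /next; case: ex_minnP => m /andP[].
have nextS N : S (next N) by rewrite /next; case: ex_minnP => m /andP[].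
have next_min N i : (N <= i)%N -> S i -> (next N <= i)%N.
  by move=> Ni Si; rewrite /next; case: ex_minnP => m _; apply; rewrite Ni.
have p_incr : {homo p : i j / (i < j)%N}.
  by apply: homo_ltn => [? ? ?|n]; [apply: ltn_trans|rewrite pS; apply: next_ge].
exists p; split=> // [[|k]|i Si]; rewrite ?pS //; first exact: nextS.
have p0i : (p 0 <= i)%N by apply: next_min.
have p_bnd k : (p k <= i)%N -> (k <= i)%N by apply: leq_trans; apply: increasing_ge_id.
have [k pki k_max] := ex_maxnP (ex_intro (fun k => p k <= i)%N 0 p0i) p_bnd.
exists k; apply/eqP; rewrite eqn_leq pki leqNgt; apply/negP => lt_pi.
by have := k_max k.+1; rewrite pS next_min // ltnn => /(_ isT).
Qed.

Lemma prod_over_range (A : comNzRingType) (S : pred nat) (p : nat -> nat) (f : nat -> A) n :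
  {homo p : i j / (i < j)%N} -> (forall i, S i <-> exists k, p k = i) ->
  \prod_(0 <= i < p n | S i) f i = \prod_(0 <= k < n) f (p k).
Proof.
move=> p_incr Sp; have p_le i j : (i <= j)%N -> (p i <= p j)%N.
  by rewrite leq_eqVlt => /predU1P[-> //|/p_incr/ltnW].
have lt_idx i j : (p i < p j)%N -> (i < j)%N.
  by move=> lt_p; rewrite ltnNge; apply/negP => /p_le; rewrite leqNgt lt_p.
have none a b (h : forall j, ~~ (a <= p j < b)%N) : \prod_(a <= i < b | S i) f i = 1.
  rewrite big_nat_cond big_pred0 // => i; apply/negP => /andP[ab /Sp[j pj]].
  by have := h j; rewrite pj ab.
elim: n => [|n IH].
  by rewrite none ?big_geq // => j; apply/negP => /= /lt_idx.
rewrite (big_cat_nat (n := p n)) ?p_le //= IH big_nat_recr //=; congr (_ * _).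
rewrite big_mkcond big_ltn ?p_incr // -big_mkcond /= ifT; last by apply/Sp; exists n.
rewrite none ?mulr1 // => j; apply/negP => /andP[/lt_idx nj /lt_idx]; lia.
Qed.

Section Existence.
Variable R : realType.

(** The products over k < n are the values of the Euler product of the range
    at p n; a monotone sequence has the limit of any of its subsequences. *)
Lemma euler_prod_range_cvg (S : pred nat) (p : nat -> nat) (L : R) :
  {homo p : i j / (i < j)%N} -> (forall k, prime (p k)) ->
  (forall i, S i <-> exists k, p k = i) ->
  euler_prod R S @ \oo --> L <->
  (fun n => \prod_(0 <= k < n) (1 - (p k)%:R^-1) : R) @ \oo --> L.
Proof.
move=> p_incr p_prime Sp.
have S_prime i : S i -> prime i by move=> /Sp[k <-].
have -> : (fun n => \prod_(0 <= k < n) (1 - (p k)%:R^-1) : R) = euler_prod R S \o p.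
  by apply/funext => n /=; rewrite /euler_prod (prod_over_range _ _ p_incr Sp).
have p_oo : p @ \oo --> \oo.
  move=> A [N _ NA]; exists N => // n Nn; apply: NA => /=.
  exact: leq_trans Nn (increasing_ge_id p_incr n).
have P_cvg := @euler_prod_is_cvg R S S_prime.
have sub_cvg : euler_prod R S \o p @ \oo --> limn (euler_prod R S) by apply: cvg_comp P_cvg.
split=> [PL|PL]; first exact: cvg_comp PL.
by rewrite -(cvg_unique _ sub_cvg PL).
Qed.

(** The running product that takes in every prime which keeps it above c. *)
Fixpoint greedy_prod (c : R) n : R := if n is m.+1 then
  if prime m && (c < greedy_prod c m * (1 - m%:R^-1))
  then greedy_prod c m * (1 - m%:R^-1) else greedy_prod c m else 1.

Definition greedy c n := prime n && (c < greedy_prod c n * (1 - n%:R^-1)).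

Lemma greedy_prodE c n : euler_prod R (greedy c) n = greedy_prod c n.
Proof.
elim: n => [|n IH]; first by rewrite /euler_prod big_nil.
by rewrite euler_prodS IH.
Qed.

Lemma greedy_gt c n : c < 1 -> c < euler_prod R (greedy c) n.
Proof.
by move=> c1; rewrite greedy_prodE; elim: n => //= n IH; case: ifP => // /andP[].
Qed.

(** If the limit exceeded c, every large prime would be accepted, so the
    greedy product would eventually be proportional to the Euler product over
    all primes, which tends to 0. *)
Lemma greedy_cvg c : 0 < c < 1 -> euler_prod R (greedy c) @ \oo --> c.
Proof.
move=> /andP[c0 c1]; have S_prime i : greedy c i -> prime i by case/andP.
have P_cvg := @euler_prod_is_cvg R _ S_prime.
set L : R := limn (euler_prod R (greedy c)).
have cL : c <= L by apply: limr_ge => //; apply: nearW => n; rewrite ltW // greedy_gt.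
suff eq_cL : c = L by rewrite [X in _ --> X]eq_cL; exact: P_cvg.
apply/eqP; rewrite eq_le cL leNgt; apply/negP => ltcL.
have L0 := lt_trans c0 ltcL.
have [N _ /(_ _ (leq_addr _ _)) NB] : \forall N \near \oo, (L / (L - c)) <= N%:R.
  exact: nbhs_infty_ger.
have take_all n : (N < n)%N -> greedy c n = prime n.
  move=> Nn; rewrite /greedy -greedy_prodE andb_idr // => pn.
  apply: (@lt_le_trans _ _ (L * (1 - n%:R^-1))); last first.
    by rewrite ler_pM2r ?euler_prod_ge_lim // (@euler_factor_gt0 R prime).
  have n0 : 0 < n%:R :> R by rewrite ltr0n prime_gt0.
  have : L / (L - c) < n%:R by apply: le_lt_trans (NB 0%N) _; rewrite addn0 ltr_nat.
  rewrite ltr_pdivrMr ?subr_gt0 // => h.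
  by rewrite mulrBr mulr1 ltrBrDl -ltrBrDr ltr_pdivrMr // mulrC.
have prP (i : nat) : prime i -> prime i by [].
pose N1 := N.+1.
(* Beyond N1 both products acquire the same factors. *)
have PQ n : (N1 <= n)%N ->
    euler_prod R (greedy c) n * euler_prod R prime N1 =
    euler_prod R (greedy c) N1 * euler_prod R prime n.
  elim: n => // n IH; rewrite leq_eqVlt => /predU1P[<- //|lt_n].
  rewrite 2!(euler_prodS _ _ n) take_all //; case: ifP => _; rewrite ?IH //.
  by rewrite mulrA -IH // mulrAC.
have Q0 : 0 < euler_prod R prime N1 by apply: euler_prod_gt0.
have LQ0 : 0 < L * euler_prod R prime N1 by rewrite mulr_gt0.
have /cvgrPdist_lt/(_ _ LQ0)[M _ /(_ (N1 + M)%N (leq_addl _ _))] := @euler_prod_primes_cvg0 R.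
rewrite sub0r normrN ltNge => /negP; apply.
rewrite gtr0_norm ?euler_prod_gt0 //.
apply: le_trans (_ : euler_prod R (greedy c) (N1 + M) * euler_prod R prime N1 <= _).
  by rewrite ler_pM2r // euler_prod_ge_lim.
rewrite PQ ?leq_addr // ler_piMl ?euler_prod_le1 // ltW // euler_prod_gt0 //.
Qed.

(** The greedy set is infinite, since its product converges to 1 - D but
    never reaches it. *)
Lemma admissible_primes_exist (D : R) : 0 < D < 1 -> exists p, admissible_primes D p.
Proof.
move=> /andP[D0 D1]; have c01 : 0 < 1 - D < 1 by apply/andP; split; lra.
have S_prime i : greedy (1 - D) i -> prime i by case/andP.
have P_cvg := greedy_cvg c01.
have S_inf N : exists2 n, (N <= n)%N & greedy (1 - D) n.
  apply: contrapT => /forall2NP noS.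
  have : 1 - D < euler_prod R (greedy (1 - D)) N by apply: greedy_gt; lra.
  suff P_const : \forall n \near \oo, euler_prod R (greedy (1 - D)) N =
      euler_prod R (greedy (1 - D)) n.
    have : euler_prod R (greedy (1 - D)) @ \oo --> euler_prod R (greedy (1 - D)) N.
      exact: cvg_trans (near_eq_cvg P_const) (cvg_cst _).
    by move=> /(cvg_unique _ P_cvg) <- //; rewrite ltxx.
  exists N => // n /= Nn; elim: n Nn => [|n IH]; first by rewrite leqn0 => /eqP->.
  rewrite leq_eqVlt => /predU1P[<- //|lt_Nn]; rewrite IH // euler_prodS.
  by case: ifP => // Sn; case: (noS n); rewrite ?Sn //; case.
have [p [p_incr pS Sp]] := enumerate_infinite S_inf.
exists p; split=> // [k|]; first exact: S_prime.
apply/(euler_prod_range_cvg (S := greedy (1 - D))) => // [k|i]; first exact: S_prime.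
by split=> [/Sp //|[k <-]].
Qed.

End Existence.

(** * Unconditional summation of absolutely convergent series *)

Section Unconditional.
Variables (K : numFieldType).

Lemma ell1_tail (z : nat -> K) : ell1 z -> forall e : K, 0 < e ->
  exists N, forall M, (N <= M)%N -> \sum_(N <= i < M) `|z i| <= e.
Proof.
move=> /cvg_ex[/= t zt] e e0; have e20 : 0 < e / 2 by rewrite divr_gt0.
have /cvgrPdist_le/(_ _ e20)[N _ NB] := zt.
exists N => M NM; rewrite -[leLHS]ger0_norm ?sumr_ge0 //.
rewrite -sub_series_geq // [e]splitr.
by apply: (le_trans (ler_distD t _ _)); apply: lerD; [rewrite distrC|]; apply: NB => /=.
Qed.

Lemma cvg_seq_bound (u : nat -> K) : cvgn u -> exists2 B : K, 0 < B & forall i, `|u i| <= B.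
Proof.
move=> /cvg_seq_bounded[M [M_real MB]]; exists (`|M| + 1); first by rewrite ltr_wpDl.
move=> i; apply: (MB (`|M| + 1)) => //.
by apply: le_lt_trans (real_ler_norm M_real) _; rewrite ltrDl.
Qed.

Lemma ell1_cvg0 (z : nat -> K) : ell1 z -> z @ \oo --> (0 : K).
Proof. by move=> /cvg_series_cvg_0 /norm_cvg0P. Qed.

Lemma ell1_bounded (z : nat -> K) : ell1 z -> exists2 B : K, 0 < B & forall i, `|z i| <= B.
Proof. by move=> /ell1_cvg0/cvgP; apply: cvg_seq_bound. Qed.

Lemma sum_nat_split (z : nat -> K) (A : seq nat) (M : nat) :
  uniq A -> (forall i, i \in A -> (i < M)%N) ->
  \sum_(0 <= i < M) z i = \sum_(i <- A) z i + \sum_(0 <= i < M | i \notin A) z i.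
Proof.
move=> uA AM; rewrite (bigID [in A]) /=; congr (_ + _); rewrite -big_filter.
apply: perm_big; apply: uniq_perm => //; first by rewrite filter_uniq ?iota_uniq.
by move=> i; rewrite mem_filter mem_index_iota andb_idr //; apply: AM.
Qed.

(** The error is a sum over indices all beyond N, bounded by an absolute
    tail. *)
Lemma ell1_unconditional (z : nat -> K) (s : K) : ell1 z -> series z @ \oo --> s ->
  forall e : K, 0 < e -> exists N, forall A : seq nat, uniq A ->
    (forall i, (i < N)%N -> i \in A) -> `|s - \sum_(i <- A) z i| <= e.
Proof.
move=> z1 zs e e0; have e20 : 0 < e / 2 by rewrite divr_gt0.
have [N NB] := ell1_tail z1 e20; exists N => A uA NA.
have /cvgrPdist_le/(_ _ e20)[N1 _ N1B] := zs.
(* M lies beyond both thresholds and beyond all of A. *)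
pose M := (N + N1 + \max_(i <- A) i.+1)%N.
have AM i : i \in A -> (i < M)%N.
  move=> iA; apply: leq_trans (leq_addl _ _).
  by rewrite (big_rem i) //= leq_max leqnn.
rewrite [e]splitr; apply: (le_trans (ler_distD (series z M) _ _)); apply: lerD.
  by apply: N1B; rewrite /= /M -addnA addnCA leq_addr.
rewrite /series /= (sum_nat_split z uA AM) addrC addKr.
apply: le_trans (ler_norm_sum _ _ _) _.
have NM : (N <= M)%N by rewrite /M -addnA leq_addr.
apply: le_trans (NB M NM); rewrite (big_cat_nat (n := N)) //=.
rewrite big_nat_cond big_pred0 ?add0r; last first.
  by move=> i; apply/negP => /andP[/andP[_ /NA ->]].
by rewrite big_mkcond ler_sum // => i _; case: ifP.
Qed.

(** The form of unconditional convergence used for both enumerations: the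
    finite sets exhaust the integers in an arbitrary manner. *)
Lemma ell1_rearrange (z : nat -> K) (s : K) (A : nat -> seq nat) :
  ell1 z -> series z @ \oo --> s -> (forall n, uniq (A n)) ->
  (forall i, \forall n \near \oo, i \in A n) ->
  (fun n => \sum_(i <- A n) z i) @ \oo --> s.
Proof.
move=> z1 zs uA covA; apply/cvgrPdist_le => e e0.
have [N NB] := ell1_unconditional z1 zs e0.
have : \forall n \near \oo, forall i, (i < N)%N -> i \in A n.
  elim: N {NB} => [|N IH]; first by apply: nearW.
  near=> n => i; rewrite ltnS leq_eqVlt => /predU1P[->|iN]; first by near: n.
  by move: i iN; near: n.
by apply: filterS => n nA; apply: NB.
Unshelve. all: by end_near. Qed.

End Unconditional.

(** * Absolute convergence over the complex numbers *)

Section Complex.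
Variable R : realType.
Local Notation C := (R[i] : numFieldType).

Lemma normc_real (x : R) : `|x%:C| = `|x|%:C.
Proof. by rewrite normc_def /= expr0n addr0 sqrtr_sqr. Qed.

Lemma normc_ge_Im (z : C) : `|complex.Im z|%:C <= `|z|.
Proof.
rewrite normc_def lecR -sqrtr_sqr ler_wsqrtr // lerDr sqr_ge0 //.
Qed.

Lemma gt0_complexE (e : C) : 0 < e -> e = (complex.Re e)%:C /\ 0 < complex.Re e.
Proof. by case: e => a b; rewrite ltcE /= => /andP[/eqP -> ->]. Qed.

Lemma cvg_real_complex (u : nat -> R) (l : R) : u @ \oo --> l ->
  (fun n => (u n)%:C : C) @ \oo --> (l%:C : C).
Proof.
move=> ul; apply/cvgrPdist_lt => e /gt0_complexE[-> e0].
move/cvgrPdist_lt: ul => /(_ _ e0); apply: filterS => n.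
by rewrite -rmorphB /= normc_real ltcR.
Qed.

Lemma cvg_complex_Re (u : nat -> C) (l : C) : u @ \oo --> l ->
  (fun n => complex.Re (u n)) @ \oo --> complex.Re l.
Proof.
move=> ul; apply/cvgrPdist_lt => e e0.
have : 0 < e%:C :> C by rewrite ltcR.
move/cvgrPdist_lt: ul => /[apply]; apply: filterS => n h.
rewrite -ltcR; apply: le_lt_trans h; rewrite -raddfB; exact: normc_ge_Re.
Qed.

Lemma cvg_series_comparison (u v : nat -> R) : (forall n, `|u n| <= v n) ->
  cvgn (series v) -> cvgn (series u).
Proof.
move=> uv v_cvg; apply: normed_cvg; apply: series_le_cvg v_cvg => // n.
  by rewrite /=.
by apply: le_trans (uv n).
Qed.

Lemma ell1_Re_norm (z : nat -> C) : ell1 z -> cvgn (series (fun n => complex.Re `|z n|)).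
Proof.
move=> /cvg_ex[/= l zl]; apply/cvg_ex; exists (complex.Re l).
have -> : series (fun n => complex.Re `|z n|) = (fun n => complex.Re ([normed series z] n)).
  by apply/funext => n; rewrite /series /= raddf_sum.
exact: cvg_complex_Re.
Qed.

Lemma norm_realE (z : C) : `|z| = (complex.Re `|z|)%:C.
Proof. by rewrite normc_def. Qed.

(** The comparison test takes place among the real parts of the norms; the
    result is transported back to complex-valued partial sums. *)
Lemma ell1_comparison (w z : nat -> C) (c : R) :
  (forall i, `|w i| <= c%:C * `|z i|) -> ell1 z -> ell1 w.
Proof.
move=> wz /ell1_Re_norm z1.
have w_cvg : cvgn (series (fun n => complex.Re `|w n|)).
  apply: cvg_series_comparison (is_cvg_seriesZ (k := c) z1) => n.
  rewrite -lecR -normc_real -norm_realE normr_id (le_trans (wz n)) //.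
  by rewrite [in leLHS](norm_realE (z n)) -rmorphM.
rewrite /ell1; have -> : [normed series w] =
    (fun n => (series (fun n => complex.Re `|w n|) n)%:C : C).
  apply/funext => n; rewrite /series /= rmorph_sum.
  by apply: eq_bigr => i _; apply: norm_realE.
by apply/cvg_ex; exists (limn (series (fun n => complex.Re `|w n|)))%:C; apply: cvg_real_complex.
Qed.

(** Completeness is used for the real and imaginary parts separately. *)
Lemma ell1_cvg (z : nat -> C) : ell1 z -> cvgn (series z).
Proof.
move=> /ell1_Re_norm z1.
have cRe : cvgn (series (fun n => complex.Re (z n))).
  by apply: cvg_series_comparison z1 => n; rewrite -lecR -norm_realE normc_ge_Re.
have cIm : cvgn (series (fun n => complex.Im (z n))).
  by apply: cvg_series_comparison z1 => n; rewrite -lecR -norm_realE normc_ge_Im.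
have -> : series z = (fun n => (series (fun n => complex.Re (z n)) n)%:C +
    'i%C * (series (fun n => complex.Im (z n)) n)%:C).
  apply/funext => n; rewrite /series /= !rmorph_sum mulr_sumr -big_split /=.
  by apply: eq_bigr => i _; apply: complexE.
apply/cvg_ex; exists ((limn (series (fun n => complex.Re (z n))))%:C +
  'i%C * (limn (series (fun n => complex.Im (z n))))%:C : C).
apply: cvgD; first exact: cvg_real_complex.
by apply: cvgMr; apply: cvg_real_complex.
Qed.

End Complex.

(** * Sums of powers of a p-th root of unity *)

Section Roots.
Variable R : realType.
Local Notation C := (R[i] : numFieldType).

Definition cis (x : R) : C := cos x +i* sin x.

Lemma cisD x y : cis (x + y) = cis x * cis y.
Proof.
apply/eqP; rewrite eq_complex /= cosD sinD eqxx /=.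
by rewrite addrC eqxx.
Qed.

Lemma cis0 : cis 0 = 1.
Proof. by rewrite /cis cos0 sin0. Qed.

Lemma cisX x n : cis x ^+ n = cis (x * n%:R).
Proof.
elim: n => [|n IH]; first by rewrite mulr0 cis0.
by rewrite exprSr IH -cisD -natr1 mulrDr mulr1.
Qed.

Lemma norm_cis x : `|cis x| = 1.
Proof. by rewrite normc_def /= cos2Dsin2 sqrtr1. Qed.

Lemma omega_rootE n h : omega_root R n ^+ h = cis (2 * pi / n%:R * h%:R).
Proof. exact: cisX. Qed.

Lemma omega_root_exp n : (0 < n)%N -> omega_root R n ^+ n = 1.
Proof.
move=> n0; rewrite omega_rootE divfK ?pnatr_eq0 -?lt0n //.
by rewrite /cis mulrC mulr_natr cos2pi sin2pi.
Qed.

Lemma norm_omega_root n h : `|omega_root R n ^+ h| = 1.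
Proof. by rewrite omega_rootE norm_cis. Qed.

(** For 0 < h <= p / 2 some multiple n h / p with n <= p / (4 h) + 1 lies in
    [1/4, 3/4], so u^n, with u the h-th power of the root, is in the left half
    plane and |1 - u^n| >= 1. As |1 - u^n| <= n |1 - u|, this bounds |1 - u|
    from below. *)
Lemma omega_root_away_from1 p h : (0 < h)%N -> (h.*2 <= p)%N ->
  1 <= `|1 - omega_root R p ^+ h| * (p %/ (4 * h)).+1%:R.
Proof.
move=> h0 hp; set n := (p %/ (4 * h)).+1; set u := omega_root R p ^+ h.
have p0 : (0 < p)%N by lia.
have n_ge : (p <= 4 * (h * n))%N.
  by rewrite mulnA mulnC ltnW // /n ltn_ceil // muln_gt0.
have n_le : (4 * (h * n) <= 3 * p)%N.
  by rewrite mulnA mulnC /n mulSn; have := leq_trunc_div p (4 * h); lia.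
apply: (@le_trans _ _ `|1 - u ^+ n|).
  rewrite /u -exprM omega_rootE.
  apply: le_trans (normc_ge_Re _); rewrite lecR /=.
  set x := 2 * pi / p%:R * _.
  have pp : 0 < p%:R :> R by rewrite ltr0n.
  have pi0 : 0 < pi :> R := pi_gt0 R.
  have xE : x = (4 * (h * n))%:R / p%:R * (pi / 2) by rewrite !natrM /x; field; rewrite gt_eqF.
  have x1 : pi / 2 <= x.
    by rewrite xE ler_peMl ?divr_ge0 ?pi_ge0 // ler_pdivlMr // mul1r ler_nat.
  have x3 : x <= 3 * (pi / 2).
    by rewrite xE ler_pM2r ?divr_gt0 // ler_pdivrMr // -natrM ler_nat.
  have : 0 <= cos (x - pi) by apply: cos_ge0_pihalf; apply/andP; split; lra.
  have -> : cos x = - cos (x - pi) by rewrite -cosDpi subrK.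
  by move=> c0; apply: le_trans (ler_norm _); lra.
have -> : 1 - u ^+ n = (1 - u) * \sum_(i < n) u ^+ i by rewrite -opprB subrX1 -mulNr opprB.
rewrite normrM ler_wpM2l //; apply: le_trans (ler_norm_sum _ _ _) _.
rewrite (eq_bigr (fun=> 1)) ?sumr_const ?card_ord // => i _.
by rewrite /u -exprM norm_omega_root.
Qed.

Lemma omega_root_neq1 p : (1 < p)%N -> omega_root R p != 1.
Proof.
move=> p1; apply/eqP => w1; have := @omega_root_away_from1 p 1 isT p1.
by rewrite expr1 w1 subrr normr0 mul0r ler10.
Qed.

(** The order of the root divides the prime p and is not 1. *)
Lemma omega_root_eq1 p m : prime p -> (omega_root R p ^+ m == 1) = (p %| m)%N.
Proof.
move=> p_pr; have p0 := prime_gt0 p_pr.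
have [q q_prim qp] := prim_order_exists p0 (omega_root_exp p0).
suff q_eq : q = p by rewrite -(prim_order_dvd q_prim) q_eq.
case/primeP: p_pr => p1 /(_ _ qp)/orP[] /eqP q1; last exact: q1.
by have := prim_expr_order q_prim; rewrite q1 expr1 => /eqP; rewrite (negbTE (omega_root_neq1 p1)).
Qed.

Lemma geometric_sum_bound (u : C) n : `|u| = 1 -> `|1 - u| * `|\sum_(i < n) u ^+ i| <= 2.
Proof.
move=> u1; rewrite -normrM -opprB mulNr -subrX1 opprB.
by apply: le_trans (ler_normB _ _) _; rewrite normr1 normrX u1 expr1n.
Qed.

Lemma sum_omega_root p m : prime p ->
  \sum_(l < p) (omega_root R p ^+ l) ^+ m = if (p %| m)%N then p%:R else 0.
Proof.
move=> p_pr; have p0 := prime_gt0 p_pr.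
under eq_bigr do rewrite exprAC.
rewrite -omega_root_eq1 //; case: eqP => [->|/eqP w1].
  by under eq_bigr do rewrite expr1n; rewrite sumr_const card_ord.
have : (omega_root R p ^+ m - 1) * \sum_(l < p) (omega_root R p ^+ m) ^+ l = 0.
  by rewrite -subrX1 exprAC omega_root_exp // expr1n subrr.
by move/eqP; rewrite mulf_eq0 subr_eq0 (negbTE w1) => /eqP.
Qed.

(** The l-th root listed in block k is the one of exponent g l, g = [stride p k].
    Two requirements fix the value g: g / p is about 1 / (k + 2), so that the
    angle of the m-th powers is not small, and g m / p <= 1/2 as long as
    2 m <= k + 2. *)
Definition stride (p k : nat) : nat := (p %/ k.+2)%N.

(** A geometric sum is at most 2 / |1 - u|, and [omega_root_away_from1] applies to
    the ratio u, of exponent g m, with n <= k + 2. The bound does not depend on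
    p, which may grow arbitrarily fast with k. *)
Lemma stride_partial_sum p k m L : (k.+2 <= p)%N -> (0 < m)%N -> (m.*2 <= k.+2)%N ->
  `|\sum_(l < L) (omega_root R p ^+ (stride p k * l)) ^+ m| <= (2 * k.+2)%:R.
Proof.
move=> kp m0 mk; set g := stride p k; have p0 : (0 < p)%N by lia.
have g0 : (0 < g)%N by rewrite divn_gt0.
have gp : (g * k.+2 <= p)%N := leq_trunc_div p k.+2.
have pg : (p < 2 * g * k.+2)%N.
  apply: leq_trans (ltn_ceil p (isT : 0 < k.+2)%N) _.
  by rewrite -/g leq_mul2r /= mul2n -addnn -addn1 leq_add2l.
have h0 : (0 < g * m)%N by rewrite muln_gt0 g0.
have hp : ((g * m).*2 <= p)%N by rewrite -muln2 -mulnA muln2 (leq_trans _ gp) // leq_mul2l mk orbT.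
have := omega_root_away_from1 h0 hp; set n := (_ %/ _).+1 => dist1.
have n_le : (n <= k.+2)%N.
  have : (p < k.+2 * (4 * (g * m)))%N by apply: (leq_trans pg); nia.
  by rewrite -ltn_divLR // !muln_gt0 g0.
under eq_bigr do rewrite -exprM mulnAC exprM.
have := @geometric_sum_bound _ L (norm_omega_root p (g * m)).
have := normr_ge0 (1 - omega_root R p ^+ (g * m)).
have := normr_ge0 (\sum_(i < L) (omega_root R p ^+ (g * m)) ^+ i).
move: dist1; move: `|_| `|1 - _| => s d dist1 s0 d0 ds.
apply: le_trans (_ : s * (d * n%:R) <= _); first by rewrite ler_peMr.
rewrite mulrA [s * d]mulrC natrM; apply: ler_pM => //; last by rewrite ler_nat.
by rewrite mulr_ge0.
Qed.

End Roots.

(** * The moments of an absolutely convergent enumeration *)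

Section Moments.
Variable R : realType.
Local Notation C := (R[i] : numFieldType).
Variables (eta : nat -> C) (p : nat -> nat).
Hypotheses (p_incr : {homo p : i j / (i < j)%N}) (p_prime : forall k, prime (p k)).
Hypothesis eta_ell1 : ell1 eta.

Lemma prime_seq_ge k : (k.+2 <= p k)%N.
Proof.
elim: k => [|k IH]; first exact: prime_gt1.
by apply: leq_ltn_trans IH (p_incr _).
Qed.

Definition triple (k j : nat) (l : 'I_(p k)) : index_I p := existT _ k (j, l).

Lemma elt_IX k j (l : 'I_(p k)) m :
  elt_I eta (triple j l) ^+ m =
  eta j ^+ m * ((omega_root R (p k) ^+ l) ^+ m / (2 ^+ k) ^+ m) :> C.
Proof. by rewrite /elt_I /triple exprMn expr_div_n. Qed.

(** The factor that block k contributes to the m-th moment. *)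
Definition weight (m k : nat) : C := (if (p k %| m)%N then (p k)%:R else 0) / (2 ^+ k) ^+ m.

Lemma block_sum k j m :
  \sum_(l < p k) elt_I eta (triple j l) ^+ m = weight m k * eta j ^+ m :> C.
Proof.
under eq_bigr do rewrite elt_IX.
by rewrite -mulr_sumr -mulr_suml sum_omega_root // mulrC.
Qed.

(** The sum of all the weights when m > 0: those with k >= m vanish because
    p k > k. *)
Definition total_weight (m : nat) : C := \sum_(0 <= k < m) weight m k.

Lemma weight_eq0 m k : (0 < m)%N -> (m <= k)%N -> weight m k = 0.
Proof.
move=> m0 mk; rewrite /weight; case: ifPn => [/(dvdn_leq m0)|_]; last by rewrite mul0r.
by have := prime_seq_ge k; lia.
Qed.

Lemma sum_weight m K : (0 < m)%N -> (m <= K)%N ->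
  \sum_(0 <= k < K) weight m k = total_weight m.
Proof.
move=> m0 mK; rewrite (big_cat_nat (n := m)) //=.
rewrite [X in _ + X]big_nat_cond [X in _ + X]big1 ?addr0 //.
by move=> k /andP[/andP[mk _] _]; apply: weight_eq0.
Qed.

(** The weights are nonnegative, and positive exactly when p k divides m. *)
Lemma total_weight_eq0 m : (0 < m)%N ->
  total_weight m = 0 <-> forall k, ~~ (p k %| m)%N.
Proof.
move=> m0; have w_ge0 k : 0 <= weight m k.
  by rewrite divr_ge0 ?exprn_ge0 //; case: ifP.
split=> [w0 k|ndiv]; last first.
  by rewrite /total_weight big1 // => k _; rewrite /weight (negbTE (ndiv k)) mul0r.
apply/negP => pk_m; case: (ltnP k m) => [km|mk]; last first.
  by have := dvdn_leq m0 pk_m; have := prime_seq_ge k; lia.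
have : weight m k <= total_weight m.
  rewrite /total_weight (big_rem k) /= ?mem_index_iota // lerDl.
  by rewrite sumr_ge0.
apply/negP; rewrite w0 /weight pk_m lt_geF // divr_gt0 ?exprn_gt0 // ltr0n; exact: prime_gt0.
Qed.

Lemma eta_expr_ell1 m : (0 < m)%N -> ell1 (fun j => eta j ^+ m).
Proof.
move=> m0; have [B B0 eta_le] := ell1_bounded eta_ell1.
have [BE _] := gt0_complexE B0.
refine (@ell1_comparison R (fun j => eta j ^+ m) eta (complex.Re B ^+ m.-1) _ eta_ell1) => j.
rewrite rmorphXn /= -BE normrX -[in leLHS](prednK m0) exprSr ler_wpM2r //.
by rewrite lerXn2r // ?nnegrE // ltW.
Qed.

Lemma eta_moment_cvg m : (0 < m)%N -> moment_series eta m @ \oo --> moment eta m.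
Proof. by move=> m0; apply: ell1_cvg (eta_expr_ell1 m0). Qed.

Lemma elt_I_bounded : exists2 B : C, 0 < B & forall t : index_I p, `|elt_I eta t : C| <= B.
Proof.
have [B B0 eta_le] := ell1_bounded eta_ell1.
exists B => // -[k [j l]]; apply: le_trans (eta_le j).
rewrite -[elt_I _ _]expr1 elt_IX !expr1 normrM normf_div norm_omega_root normrX.
rewrite ler_piMr // mul1r invf_le1 ?exprn_gt0 ?normr_gt0 // exprn_ege1 //.
by rewrite ger0_norm // ler1n.
Qed.

Lemma elt_I_expr_ell1 (xi : nat -> index_I p) q m : (q <= m)%N ->
  ell1 (fun i => (elt_I eta (xi i) : C) ^+ q) -> ell1 (fun i => (elt_I eta (xi i) : C) ^+ m).
Proof.
move=> qm; have [B B0 B_le] := elt_I_bounded; have [BE _] := gt0_complexE B0.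
move=> z1.
refine (@ell1_comparison R (fun i => (elt_I eta (xi i) : C) ^+ m)
  (fun i => (elt_I eta (xi i) : C) ^+ q) (complex.Re B ^+ (m - q)) _ z1) => i.
rewrite rmorphXn /= -BE -[in leLHS](subnK qm) exprD normrM ler_wpM2r //.
by rewrite normrX lerXn2r // ?nnegrE // ltW.
Qed.

(** Finite sets of triples exhausting the index set, on which the sum of the
    m-th powers factors as a sum over k times a partial moment of eta. *)
Definition box (J : nat) : seq {k : nat & (nat * 'I_(p k))%type} :=
  [seq existT (fun k => (nat * 'I_(p k))%type) k x | k <- iota 0 J,
    x <- [seq (j, l) | j <- iota 0 J, l <- enum 'I_(p k)]].

Lemma box_uniq J : uniq (box J).
Proof.
apply: allpairs_uniq_dep => [|k _|]; rewrite ?iota_uniq //.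
  by apply: allpairs_uniq; rewrite ?iota_uniq ?enum_uniq // => -[? ?] [? ?].
by move=> [k x] [k2 x2] _ _ /=.
Qed.

Lemma mem_box J k j (l : 'I_(p k)) : (k < J)%N -> (j < J)%N ->
  existT (fun k => (nat * 'I_(p k))%type) k (j, l) \in box J.
Proof.
move=> kJ jJ; apply: allpairs_f_dep; rewrite ?mem_iota //.
by apply: allpairs_f; rewrite ?mem_iota ?mem_enum.
Qed.

Lemma sum_box J m :
  \sum_(t <- box J) (elt_I eta (t : index_I p) : C) ^+ m =
  (\sum_(0 <= k < J) weight m k) * moment_series eta m J.
Proof.
rewrite big_allpairs_dep /= mulr_suml /index_iota subn0; apply: eq_bigr => k _.
rewrite big_allpairs_dep /= /moment_series /series /= /index_iota subn0 mulr_sumr.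
apply: eq_bigr => j _; rewrite -block_sum big_enum.
by apply: eq_bigr.
Qed.

(** The moment may be computed along the boxes, where for J >= m it is the
    total weight times the J-th partial moment of eta. *)
Lemma abs_moment_cvg (xi : nat -> index_I p) m : (0 < m)%N -> bijective xi ->
  ell1 (fun i => (elt_I eta (xi i) : C) ^+ m) ->
  moment_series (fun i => elt_I eta (xi i) : C) m @ \oo --> total_weight m * moment eta m.
Proof.
move=> m0 [xinv xiK xinvK] z1.
have zs := ell1_cvg z1; set s : C := limn _ in zs.
have box_cvg : (fun J => \sum_(i <- map xinv (box J)) (elt_I eta (xi i) : C) ^+ m) @ \oo --> s.
  apply: (ell1_rearrange z1 zs) => [J|i].
    by rewrite map_inj_uniq ?box_uniq //; apply: (can_inj xinvK).
  case xiE: (xi i) => [k [j l]]; exists (k + j).+1 => // J /= kjJ.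
  apply/mapP; exists (xi i); last by rewrite xiK.
  by rewrite xiE; apply: mem_box; lia.
have lim2 : (fun J => total_weight m * moment_series eta m J) @ \oo -->
    total_weight m * moment eta m.
  by apply: cvgMr; apply: eta_moment_cvg.
suff eq_s : s = total_weight m * moment eta m by rewrite -eq_s; exact: zs.
have cvg2 : (fun J => \sum_(i <- map xinv (box J)) (elt_I eta (xi i) : C) ^+ m) @ \oo -->
    total_weight m * moment eta m; last first.
  by refine (cvg_unique _ box_cvg cvg2).
apply: cvg_trans lim2.
apply: near_eq_cvg; exists m => // J /= mJ.
rewrite big_map -(sum_weight m0 mJ) -sum_box; apply: eq_bigr => t _.
by rewrite xinvK.
Qed.

End Moments.

(** * Series obtained by concatenating finite blocks *)

Section Concatenation.
Variable s : nat -> nat.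
Hypothesis s_gt0 : forall n, (0 < s n)%N.

Definition offset (n : nat) : nat := (\sum_(i < n) s i)%N.

Lemma offsetS n : offset n.+1 = (offset n + s n)%N.
Proof. by rewrite /offset big_ord_recr. Qed.

Lemma offset_le n n' : (n <= n')%N -> (offset n <= offset n')%N.
Proof.
elim: n' => [|n' IH]; first by rewrite leqn0 => /eqP->.
rewrite leq_eqVlt => /predU1P[-> //|/IH le_n].
by rewrite offsetS (leq_trans le_n) // leq_addr.
Qed.

Lemma offset_decomp x : exists n l, (l < s n)%N /\ x = (offset n + l)%N.
Proof.
elim: x => [|x [n [l [ln ->]]]]; first by exists 0%N, 0%N; rewrite /offset big_ord0.
case: (ltnP l.+1 (s n)) => [ln'|nl]; first by exists n, l.+1; rewrite addnS.
exists n.+1, 0%N; split=> //; rewrite offsetS; lia.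
Qed.

Lemma offset_inj n l n' l' : (l < s n)%N -> (l' < s n')%N ->
  (offset n + l = offset n' + l')%N -> n = n'.
Proof.
move=> ln ln' eqx; case: (ltngtP n n') => // /offset_le; rewrite offsetS; lia.
Qed.

(** Lists the pairs (n, l) with l < s n in lexicographic order. *)
Lemma concat_enumeration (T : Type) (h : {n : nat & 'I_(s n)} -> T) : bijective h ->
  exists2 xi : nat -> T, bijective xi &
    forall n (l : 'I_(s n)), xi (offset n + l)%N = h (existT _ n l).
Proof.
move=> [hinv hK hinvK].
pose c (t : {n : nat & 'I_(s n)}) := (offset (tag t) + tagged t)%N.
have c_bij : bijective c.
  rewrite -setTT_bijective; split=> //.
    move=> [n l] [n' l'] _ _ /= eqx; have eq_n := offset_inj (ltn_ord l) (ltn_ord l') eqx.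
    move: l l' eqx; rewrite /c /=; case: _ / eq_n => l l' /addnI eq_l.
    by congr (existT _ n _); apply: val_inj.
  by move=> x _; have [n [l [ln ->]]] := offset_decomp x; exists (existT _ n (Ordinal ln)).
have [cinv cK cinvK] := c_bij; exists (h \o cinv).
  by apply: bij_comp; [exists hinv|exists c].
by move=> n l /=; rewrite -[(_ + _)%N]/(c (existT _ n l)) cK.
Qed.

Lemma series_concat (K : numFieldType) (z : nat -> K) (g : nat -> nat -> K) n L :
  (forall n l, (l < s n)%N -> z (offset n + l)%N = g n l) -> (L <= s n)%N ->
  series z (offset n + L)%N = \sum_(i < n) \sum_(l < s i) g i l + \sum_(l < L) g n l.
Proof.
move=> zg; elim: n L => [|n IHn]; elim=> [|L IHL] Ls.
- by rewrite /offset !big_ord0 /series /= big_geq // addr0.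
- by rewrite addnS seriesSr (IHL (ltnW Ls)) zg // big_ord_recr addrA.
- by rewrite addn0 offsetS IHn // big_ord0 addr0 big_ord_recr.
- by rewrite addnS seriesSr (IHL (ltnW Ls)) zg // [X in _ = _ + X]big_ord_recr addrA.
Qed.

(** The partial sums at block ends converge by hypothesis, and any other
    partial sum differs from one of them by a partial sum within a block. *)
Lemma series_concat_cvg (K : numFieldType) (z : nat -> K) (g : nat -> nat -> K)
    (b : nat -> K) (S : K) :
  (forall n l, (l < s n)%N -> z (offset n + l)%N = g n l) ->
  (fun n => \sum_(i < n) \sum_(l < s i) g i l) @ \oo --> S ->
  (forall n L, (L <= s n)%N -> `|\sum_(l < L) g n l| <= b n) -> b @ \oo --> (0 : K) ->
  series z @ \oo --> S.
Proof.
move=> zg gS gb b0; apply/cvgrPdist_le => e e0; have e20 : 0 < e / 2 by rewrite divr_gt0.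
have [N _ NB] : \forall n \near \oo,
    `|S - \sum_(i < n) \sum_(l < s i) g i l| <= e / 2 /\ `|0 - b n| <= e / 2.
  by apply: filterS2 ((cvgrPdist_le _ _).1 gS _ e20) ((cvgrPdist_le _ _).1 b0 _ e20) => n; split.
(* Past offset N, an index falls in a block n >= N. *)
exists (offset N) => // x /= Nx; have [n [l [ln x_eq]]] := offset_decomp x.
have Nn : (N <= n)%N.
  rewrite leqNgt; apply/negP => /offset_le; rewrite offsetS; lia.
have [h1 h2] := NB n Nn; rewrite x_eq (series_concat zg (ltnW ln)) opprD addrA [e]splitr.
apply: le_trans (ler_normB _ _) _; apply: lerD => //.
apply: le_trans (gb n l (ltnW ln)) _; move: h2; rewrite sub0r normrN.
by apply: le_trans; apply: real_ler_norm; apply: ger0_real; apply: le_trans (gb n 0%N isT).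
Qed.

End Concatenation.

(** * Families indexed by an enumeration of pairs *)

Section Pairs.
Variables (K : numFieldType) (e : nat -> nat * nat).
Hypothesis e_bij : bijective e.

Lemma pair_eventually_out (k0 j0 : nat) :
  \forall n \near \oo, (k0 <= (e n).1)%N \/ (j0 <= (e n).2)%N.
Proof.
have [einv eK einvK] := e_bij.
pose B := [seq (k, j) | k <- iota 0 k0, j <- iota 0 j0].
exists (\max_(q <- B) (einv q).+1)%N => // n /= nmax.
case: (leqP k0 (e n).1) => [|lt1]; [by left|case: (leqP j0 (e n).2) => [|lt2]; [by right|]].
have en_B : e n \in B by rewrite [e n]surjective_pairing; apply: allpairs_f; rewrite mem_iota.
have := leq_trans (@leq_bigmax_seq _ B xpredT (fun q => (einv q).+1) _ en_B isT) nmax.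
by rewrite eK ltnn.
Qed.

(** Outside a finite set of pairs, one of the two factors is small while the
    other one stays bounded. *)
Lemma pair_product_cvg0 (v y : nat -> K) : v @ \oo --> (0 : K) -> y @ \oo --> (0 : K) ->
  (fun n => v (e n).1 * y (e n).2) @ \oo --> (0 : K).
Proof.
move=> v0 y0.
have [Bv Bv0 vB] := cvg_seq_bound (cvgP _ v0); have [By By0 yB] := cvg_seq_bound (cvgP _ y0).
apply/cvgrPdist_le => d d0.
have dv : 0 < d / By by rewrite divr_gt0.
have dy : 0 < d / Bv by rewrite divr_gt0.
have /cvgrPdist_le/(_ _ dv)[k0 _ k0B] := v0.
have /cvgrPdist_le/(_ _ dy)[j0 _ j0B] := y0.
apply: filterS (pair_eventually_out k0 j0) => n; rewrite sub0r normrN normrM => -[/k0B|/j0B] /=;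
  rewrite sub0r normrN => h.
  by rewrite -[d](divfK (lt0r_neq0 By0)) ler_pM.
by rewrite -[d](divfK (lt0r_neq0 Bv0)) mulrC ler_pM.
Qed.

(** For each of the finitely many k that matter, the pairs enumerated so far
    with first component k exhaust the series y, in some order. *)
Lemma pair_weighted_sum_cvg (w y : nat -> K) (m : nat) (s : K) :
  (forall k, (m <= k)%N -> w k = 0) -> ell1 y -> series y @ \oo --> s ->
  (fun n => \sum_(i < n) w (e i).1 * y (e i).2) @ \oo --> (\sum_(0 <= k < m) w k) * s.
Proof.
have [einv eK einvK] := e_bij.
move=> w0 y1 ys.
pose A k n := [seq (e i).2 | i <- iota 0 n & (e i).1 == k].
have A_cvg k : (fun n => \sum_(j <- A k n) y j) @ \oo --> s.
  apply: (ell1_rearrange y1 ys) => [n|j].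
    rewrite map_inj_in_uniq ?filter_uniq ?iota_uniq // => a b.
    rewrite !mem_filter => /andP[/eqP ak _] /andP[/eqP bk _] eq2.
    by rewrite -[a]eK -[b]eK [e a]surjective_pairing [e b]surjective_pairing ak bk eq2.
  exists (einv (k, j)).+1 => // n /= nk; apply/mapP; exists (einv (k, j)); last by rewrite einvK.
  by rewrite mem_filter einvK eqxx mem_iota.
have -> : (fun n => \sum_(i < n) w (e i).1 * y (e i).2) =
    (fun n => \sum_(k < m) w k * \sum_(j <- A k n) y j).
  apply/funext => n.
  transitivity (\sum_(i < n) \sum_(k < m | (e i).1 == k :> nat) w k * y (e i).2).
    apply: eq_bigr => i _; case: (ltnP (e i).1 m) => [lt_m|le_m].
      by rewrite (big_pred1 (Ordinal lt_m)).
    rewrite w0 // mul0r big_pred0 // => k; apply/negP => /eqP ek.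
    by have := ltn_ord k; rewrite -ek ltnNge le_m.
  rewrite (exchange_big_dep xpredT) //=; apply: eq_bigr => k _.
  rewrite big_map big_filter mulr_sumr.
  rewrite -(big_mkord (fun i => (e i).1 == k) (fun i => w k * y (e i).2)).
  by rewrite /index_iota subn0.
rewrite big_mkord mulr_suml.
apply: cvg_big => [|k _]; first exact: add_continuous.
by apply: cvgMr; apply: A_cvg.
Qed.

End Pairs.

(** * The strided enumeration *)

Section Enumeration.
Variables (p : nat -> nat).
Hypotheses (p_incr : {homo p : i j / (i < j)%N}) (p_prime : forall k, prime (p k)).

(** The stride is positive and less than the prime p k, hence invertible. *)
Lemma stride_inj k : injective (fun l : 'I_(p k) => (stride (p k) k * l) %% p k)%N.
Proof.
move=> l l'; have kp := prime_seq_ge p_incr p_prime k; set g := stride _ _ => /eqP.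
have p0 : (0 < p k)%N by lia.
have g0 : (0 < g)%N by rewrite divn_gt0.
have gp : (g < p k)%N by rewrite ltn_Pdiv.
wlog le_l : l l' / (l <= l')%N.
  move=> W; case: (leqP l l') => [/W //|/ltnW le_l' eql].
  by apply/esym/W => //; rewrite eq_sym.
rewrite eq_sym eqn_mod_dvd ?leq_mul2l ?le_l ?orbT // -mulnBr.
rewrite Gauss_dvdr; last by rewrite prime_coprime // gtnNdvd.
move=> dvd; apply: val_inj => /=; apply/eqP; rewrite eqn_leq le_l -subn_eq0.
by apply: contraLR dvd; rewrite -lt0n => d0; rewrite gtnNdvd // (leq_ltn_trans (leq_subr _ _)).
Qed.

Lemma pair_enumeration : exists e : nat -> nat * nat, bijective e.
Proof.
have /card_set_bijP[f] : ([set: nat] #= [set: nat * nat])%card by rewrite card_eq_sym card_nat2.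
by rewrite setTT_bijective; exists f.
Qed.

Lemma strided_enumeration (e : nat -> nat * nat) : bijective e ->
  exists2 xi : nat -> index_I p, bijective xi &
    forall n l, (l < p (e n).1)%N -> exists2 l' : 'I_(p (e n).1),
      l' = (stride (p (e n).1) (e n).1 * l %% p (e n).1)%N :> nat &
      xi (offset (fun n => p (e n).1) n + l)%N = triple (e n).2 l'.
Proof.
move=> e_bij; have [einv eK einvK] := e_bij.
have p0 k : (0 < p k)%N by apply: prime_gt0.
pose sig k (l : 'I_(p k)) : 'I_(p k) := Ordinal (ltn_pmod (stride (p k) k * l) (p0 k)).
have sig_inj k : injective (@sig k).
  by move=> l l' /(congr1 val) /stride_inj.
pose h (t : {n : nat & 'I_(p (e n).1)}) : index_I p := triple (e (tag t)).2 (sig _ (tagged t)).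
have h_bij : bijective h.
  rewrite -setTT_bijective; split=> //.
    move=> [n l] [n' l'] _ _ /= eqh.
    have eq1 : (e n).1 = (e n').1 := congr1 (fun t : index_I p => tag t) eqh.
    have eq2 : (e n).2 = (e n').2 := congr1 (fun t : index_I p => (tagged t).1) eqh.
    have eq_n : n = n'.
      by rewrite -[n]eK -[n']eK [e n]surjective_pairing eq1 eq2 -surjective_pairing.
    move: l l' eqh {eq1 eq2}; case: _ / eq_n => l l' eqh; congr (existT _ n _).
    apply: sig_inj; apply: val_inj.
    have := congr1 (fun t : index_I p => nat_of_ord (tagged t).2) eqh.
    by [].
  suff surj q : forall n, e n = q -> forall l : 'I_(p q.1),
      exists t, h t = existT (fun k => (nat * 'I_(p k))%type) q.1 (q.2, l).
    by move=> [k [j l]] _; have [t ht] := surj (k, j) (einv (k, j)) (einvK _) l; exists t.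
  move=> n <- l; have [sinv sK sinvK] := injF_bij (@sig_inj (e n).1).
  by exists (existT _ n (sinv l)); rewrite /h /= sinvK.
have [xi xi_bij xiE] := concat_enumeration (fun n => p0 (e n).1) h_bij.
exists xi => // n l ln; exists (sig _ (Ordinal ln)) => //.
exact: xiE n (Ordinal ln).
Qed.

End Enumeration.

(** * The moments of the strided enumeration *)

Section StridedMoments.
Variable R : realType.
Local Notation C := (R[i] : numFieldType).

(** The elementary bound (k + 1) (k + 2) <= 6 * 2^k makes the sequence
    O(1 / (k + 1)). *)
Lemma linear_over_pow2_cvg0 : (fun k => (2 * k.+2)%:R / 2 ^+ k : R) @ \oo --> (0 : R).
Proof.
have quad k : (k.+1 * k.+2 <= 6 * 2 ^ k)%N.
  elim: k => [//|[|k] IH] //; rewrite expnS; nia.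
have h0 : (fun k => 12 * harmonic k : R) @ \oo --> (0 : R).
  by rewrite -[X in _ --> X](mulr0 12); apply: cvgMr; apply: cvg_harmonic.
have c0 : (fun=> 0 : R) @ \oo --> (0 : R) by exact: cvg_cst.
apply: squeeze_cvgr c0 h0.
near=> k; rewrite divr_ge0 ?exprn_ge0 //= ler_pdivrMr ?exprn_gt0 //.
rewrite mulrAC ler_pdivlMr ?ltr0n // -natrX -!natrM ler_nat.
by have := quad k; lia.
Unshelve. all: by end_near. Qed.

Variables (eta : nat -> C) (p : nat -> nat).
Hypotheses (p_incr : {homo p : i j / (i < j)%N}) (p_prime : forall k, prime (p k)).
Hypothesis eta_ell1 : ell1 eta.
Variables (m : nat) (e : nat -> nat * nat) (xi : nat -> index_I p).
Hypotheses (m_gt0 : (0 < m)%N) (e_bij : bijective e).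
Hypothesis xiE : forall n l, (l < p (e n).1)%N -> exists2 l' : 'I_(p (e n).1),
  l' = (stride (p (e n).1) (e n).1 * l %% p (e n).1)%N :> nat &
  xi (offset (fun n => p (e n).1) n + l)%N = triple (e n).2 l'.

Definition strided_term (n l : nat) : C :=
  eta (e n).2 ^+ m *
  ((omega_root R (p (e n).1) ^+ (stride (p (e n).1) (e n).1 * l)) ^+ m / (2 ^+ (e n).1) ^+ m).

Lemma strided_termE n l : (l < p (e n).1)%N ->
  (elt_I eta (xi (offset (fun n => p (e n).1) n + l)%N) : C) ^+ m = strided_term n l.
Proof.
move=> /xiE[l' l'E ->]; rewrite elt_IX l'E /strided_term.
by rewrite (expr_mod _ (omega_root_exp R (prime_gt0 (p_prime _)))).
Qed.

Lemma sum_strided_term n L : \sum_(l < L) strided_term n l =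
  eta (e n).2 ^+ m / (2 ^+ (e n).1) ^+ m *
  \sum_(l < L) (omega_root R (p (e n).1) ^+ (stride (p (e n).1) (e n).1 * l)) ^+ m.
Proof. by rewrite mulr_sumr; apply: eq_bigr => l _; rewrite /strided_term mulrAC mulrA. Qed.

(** Replacing l by g l is the same as replacing m by g m in the sum over all
    roots, and p k divides g m exactly when it divides m. *)
Lemma strided_block_sum n :
  \sum_(l < p (e n).1) strided_term n l = weight R p m (e n).1 * eta (e n).2 ^+ m.
Proof.
rewrite sum_strided_term; set k := (e n).1; set g := stride _ _.
have kp := prime_seq_ge p_incr p_prime k.
have g0 : (0 < g)%N by rewrite divn_gt0.
have gp : (g < p k)%N by rewrite ltn_Pdiv // prime_gt0.
under eq_bigr do rewrite mulnC exprM -exprM.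
rewrite sum_omega_root // Gauss_dvdr; last by rewrite prime_coprime // gtnNdvd.
by rewrite /weight [RHS]mulrC [RHS]mulrA [LHS]mulrAC.
Qed.

(** The finitely many k that are too small for [stride_partial_sum] get the
    trivial bound p k. *)
Definition strided_bound (k : nat) : C :=
  if (m.*2 <= k.+2)%N then ((2 * k.+2)%:R / 2 ^+ k : R)%:C else (p k)%:R.

Lemma strided_bound_cvg0 : strided_bound @ \oo --> (0 : C).
Proof.
have lim := cvg_real_complex linear_over_pow2_cvg0.
apply: cvg_trans lim; apply: near_eq_cvg; exists (m.*2) => // k /= mk.
by rewrite /strided_bound ifT //; lia.
Qed.

Lemma strided_partial_sum n L : (L <= p (e n).1)%N ->
  `|\sum_(l < L) strided_term n l| <= strided_bound (e n).1 * `|eta (e n).2 ^+ m|.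
Proof.
move=> Lp; rewrite sum_strided_term; set k := (e n).1; set s := \sum_(l < L) _.
have pow_ge : (2 ^+ k : C) <= (2 ^+ k) ^+ m.
  by rewrite -[leLHS]expr1 ler_weXn2l // exprn_ege1 // ler1n.
have pow_gt0 : 0 < (2 ^+ k : C) by rewrite exprn_gt0.
rewrite !normrM [leRHS]mulrC -mulrA ler_wpM2l //.
rewrite normfV [`|(2 ^+ k) ^+ m|]gtr0_norm ?exprn_gt0 //.
rewrite mulrC ler_pdivrMr ?exprn_gt0 // /strided_bound; case: ifPn => [mk|_].
  apply: le_trans (@stride_partial_sum R (p k) k m L (prime_seq_ge p_incr p_prime k) m_gt0 mk) _.
  rewrite rmorphM fmorphV rmorphXn !rmorph_nat.
  apply: le_trans (_ : (2 * k.+2)%:R / 2 ^+ k * 2 ^+ k <= _).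
    by rewrite divfK ?lt0r_neq0.
  by apply: ler_wpM2l => //; apply: divr_ge0 => //; apply: ltW.
apply: le_trans (_ : (p k)%:R <= _); last first.
  by rewrite ler_peMr // (le_trans _ pow_ge) // exprn_ege1 // ler1n.
apply: le_trans (ler_norm_sum _ _ _) _.
rewrite (eq_bigr (fun=> 1)) ?sumr_const ?card_ord ?ler_nat // => l _.
by rewrite normrX norm_omega_root expr1n.
Qed.

Lemma strided_moment_cvg :
  moment_series (fun i => elt_I eta (xi i) : C) m @ \oo --> total_weight R p m * moment eta m.
Proof.
have y1 := eta_expr_ell1 eta_ell1 m_gt0.
have p0 n : (0 < p (e n).1)%N by apply: prime_gt0.
have block_cvg : (fun n => \sum_(i < n) \sum_(l < p (e i).1) strided_term i l) @ \oo -->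
    total_weight R p m * moment eta m.
  under eq_fun do under eq_bigr do rewrite strided_block_sum.
  apply: (pair_weighted_sum_cvg e_bij _ y1 (eta_moment_cvg eta_ell1 m_gt0)) => k mk.
  exact: weight_eq0.
apply: (series_concat_cvg p0 strided_termE block_cvg strided_partial_sum).
have y0 : (fun j => `|eta j ^+ m|) @ \oo --> (0 : C) by apply/norm_cvg0P; apply: ell1_cvg0 y1.
exact: (pair_product_cvg0 e_bij strided_bound_cvg0 y0).
Qed.

End StridedMoments.

(** * Vanishing moments and their density *)

Section Vanishing.
Variable R : realType.
Local Notation C := (R[i] : numFieldType).

Lemma moment_vanishes_iff (p : nat -> nat) (z : nat -> C) (M : C) m :
  {homo p : i j / (i < j)%N} -> (forall k, prime (p k)) -> (0 < m)%N -> M != 0 ->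
  moment_series z m @ \oo --> total_weight R p m * M ->
  moment_vanishes z m <-> (forall k, ~~ (p k %| m)%N).
Proof.
move=> p_incr p_prime m0 M0 zM; rewrite -(total_weight_eq0 R p_incr p_prime m0).
have -> : moment_vanishes z m <-> total_weight R p m * M = 0.
  rewrite /moment_vanishes /moment (cvg_lim _ zM) //.
  by split=> [[]//|]; split=> //; apply: cvgP zM.
by split=> [/eqP|->]; rewrite ?mul0r // mulf_eq0 (negbTE M0) orbF => /eqP.
Qed.

(** The hypothesis on z is common to both kinds of enumeration: absolutely
    summable from some power on, or strided. *)
Lemma moments_density (D : R) (p : nat -> nat) (eta z : nat -> C) q :
  D < 1 -> admissible_primes D p -> (forall m : nat, (1 <= m)%N -> moment eta m != 0) ->
  (forall m, (q < m)%N -> moment_series z m @ \oo --> total_weight R p m * moment eta m) ->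
  moments_vanish_with_density z (1 - D).
Proof.
move=> D1 [p_incr p_prime pD] eta_neq0 z_cvg.
pose S i := `[< exists k, p k = i >].
have SP i : S i <-> exists k, p k = i by split=> [/asboolP|?]; last exact/asboolP.
have S_prime i : S i -> prime i by move=> /SP[k <-].
apply: (@density_of_sieved R S S_prime (fun k => `[< moment_vanishes z k >]) q.+1).
- move=> m qm; have m0 : (0 < m)%N by apply: leq_ltn_trans qm.
  have vanish := moment_vanishes_iff p_incr p_prime m0 (eta_neq0 m m0) (z_cvg m qm).
  split=> [/asboolP/vanish h i /SP[k <-] //|h]; apply/asboolP/vanish => k.
  by apply: h; apply/SP; exists k.
- by rewrite subr_gt0.
- exact/(euler_prod_range_cvg _ p_incr p_prime SP).
Qed.

End Vanishing.

Theorem theorem4p3 (R : realType) (D : R) (hD : 0 < D < 1) :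
  (exists p : nat -> nat, admissible_primes D p) /\
  (forall (eta : nat -> R[i]) (p : nat -> nat),
     ell1 eta ->
     (forall m : nat, (1 <= m)%N -> moment eta m != 0) ->
     admissible_primes D p ->
     (* every enumeration lying in some l^q, so that the moments of order at
        least q are order-independent sums *)
     (forall xi : nat -> index_I p,
        bijective xi ->
        (exists q : nat, ell1 (fun i => elt_I eta (xi i) ^+ q)) ->
        moments_vanish_with_density (fun i => elt_I eta (xi i)) (1 - D)) /\
     (* and, without restriction on p, some enumeration *)
     (exists xi : nat -> index_I p,
        [/\ bijective xi,
            forall m : nat, (1 <= m)%N ->
              cvgn (moment_series (fun i => elt_I eta (xi i)) m) &
            moments_vanish_with_density (fun i => elt_I eta (xi i)) (1 - D)])).
Proof.
have /andP[D0 D1] := hD.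
split=> [|eta p eta1 eta_neq0 p_adm]; first exact: admissible_primes_exist.
have [p_incr p_prime _] := p_adm.
split=> [xi xi_bij [q zq]|].
  apply: (moments_density (q := q) D1 p_adm eta_neq0) => m qm.
  have m0 : (0 < m)%N by apply: leq_ltn_trans qm.
  apply: (abs_moment_cvg p_incr p_prime eta1 m0 xi_bij).
  exact: (elt_I_expr_ell1 eta1 (ltnW qm) zq).
have [e e_bij] := pair_enumeration.
have [xi xi_bij xiE] := strided_enumeration p_incr p_prime e_bij.
have z_cvg m (m0 : (0 < m)%N) := strided_moment_cvg p_incr p_prime eta1 m0 e_bij xiE.
exists xi; split=> [|m m0|]; first exact: xi_bij.
  exact: cvgP (z_cvg m m0).
exact: (moments_density D1 p_adm eta_neq0 z_cvg).
Qed.
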